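(* Let $P$ be a finite poset. Then mlb-closure $A\mapsto\overline{A}$ is a convex closure on the set $P$.
   Context: For $B\subseteq P$, a maximal lower bound of $B$ is a maximal element of the set $\{x\in P: x\le b \text{ for all } b\in B\}$. A subset $A\subseteq P$ is mlb-closed if for every subset $B\subseteq A$ (including $B=\emptyset$, whose maximal lower bounds are the maximal elements of $P$), all maximal lower bounds of $B$ in $P$ belong to $A$. For $A\subseteq P$, its mlb-closure $\overline{A}$ is the intersection of all mlb-closed subsets of $P$ containing $A$. A closure on a set $S$ is a map $A\mapsto\overline{A}$ from $2^S$ to $2^S$ such that for all $A,B\subseteq S$: $A\subseteq\overline{A}$; $A\subseteq B$ implies $\overline{A}\subseteq\overline{B}$; and $\overline{\overline{A}}=\overline{A}$. A closure on $S$ is a convex closure if it satisfies the anti-exchange axiom: given distinct $x,y\in S$ and a closed set $A=\overline{A}\subset S$ with $x,y\notin A$, if $x\in\overline{\{y\}\cup A}$ then $y\notin\overline{\{x\}\cup A}$. *)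

(* Defs.v *)
From mathcomp Require Import all_boot all_order.

Set Implicit Arguments.
Unset Strict Implicit.
Unset Printing Implicit Defensive.

Import Order.TTheory.
Local Open Scope order_scope.

Definition lower_bounds (d : Order.disp_t) (P : finPOrderType d)
    (B : {set P}) : {set P} :=
  [set x | [forall b in B, x <= b]].

Definition maximal_elements (d : Order.disp_t) (P : finPOrderType d)
    (L : {set P}) : {set P} :=
  [set x in L | [forall y in L, (x <= y) ==> (y == x)]].

(* [lower_bounds set0] is all of P, so the maximal lower bounds of the empty
   set are the maximal elements of P. *)
Definition max_lower_bounds (d : Order.disp_t) (P : finPOrderType d)
    (B : {set P}) : {set P} :=
  maximal_elements (lower_bounds B).

Definition mlb_closed (d : Order.disp_t) (P : finPOrderType d)
    (A : {set P}) : bool :=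
  [forall B : {set P}, (B \subset A) ==> (max_lower_bounds B \subset A)].

Definition mlb_closure (d : Order.disp_t) (P : finPOrderType d)
    (A : {set P}) : {set P} :=
  \bigcap_(C : {set P} | mlb_closed C && (A \subset C)) C.

Record is_closure (S : finType) (cl : {set S} -> {set S}) : Prop := IsClosure {
  closure_extensive : forall A : {set S}, A \subset cl A;
  closure_monotone : forall A B : {set S}, A \subset B -> cl A \subset cl B;
  closure_idempotent : forall A : {set S}, cl (cl A) = cl A
}.

Definition anti_exchange (S : finType) (cl : {set S} -> {set S}) : Prop :=
  forall (x y : S) (A : {set S}),
    x <> y -> cl A = A -> x \notin A -> y \notin A ->
    x \in cl (y |: A) -> y \notin cl (x |: A).

Definition is_convex_closure (S : finType) (cl : {set S} -> {set S}) : Prop :=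
  is_closure cl /\ anti_exchange cl.

(* Main.v *)
Require Import Defs.
From mathcomp Require Import all_boot all_order.

Import Order.TTheory.
Local Open Scope order_scope.

(** The closure axioms hold because mlb-closed sets are stable under
    intersection, which makes [mlb_closure A] the least mlb-closed superset of
    [A].  For anti-exchange, the point is that adjoining [y] to a closed set [A]
    only creates elements below [y]: the union of [A] with the principal ideal
    of [y] is already mlb-closed ([mlb_closed_setU_ideal]).  Hence if [x] and
    [y] lie outside [A] and each belongs to the closure of [A] with the other
    adjoined, then [x <= y] and [y <= x], so [x = y]. *)

Lemma mlb_closedP (d : Order.disp_t) (P : finPOrderType d) (A : {set P}) :
  reflect (forall B : {set P}, B \subset A -> max_lower_bounds B \subset A)
          (mlb_closed A).
Proof. by apply: (iffP forallP) => h B; apply/implyP/h. Qed.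

Lemma mlb_closure_min (d : Order.disp_t) (P : finPOrderType d)
    (A C : {set P}) :
  mlb_closed C -> A \subset C -> mlb_closure A \subset C.
Proof. by move=> Ccl sAC; apply: bigcap_inf; rewrite Ccl. Qed.

Lemma subset_mlb_closure (d : Order.disp_t) (P : finPOrderType d)
    (A : {set P}) : A \subset mlb_closure A.
Proof. by apply/bigcapsP => C /andP[]. Qed.

Lemma mlb_closure_closed (d : Order.disp_t) (P : finPOrderType d)
    (A : {set P}) : mlb_closed (mlb_closure A).
Proof.
apply/mlb_closedP => B sBA; apply/bigcapsP => C /andP[Ccl sAC].
apply: (mlb_closedP _ _ C Ccl).
exact: subset_trans sBA (mlb_closure_min _ _ _ _ Ccl sAC).
Qed.

Lemma mlb_closure_is_closure (d : Order.disp_t) (P : finPOrderType d) :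
  is_closure (@mlb_closure d P).
Proof.
split=> [A | A B sAB | A]; first exact: subset_mlb_closure.
  apply: mlb_closure_min (mlb_closure_closed _ _ B) _.
  exact: subset_trans sAB (subset_mlb_closure _ _ B).
apply/eqP; rewrite eqEsubset subset_mlb_closure andbT.
exact: mlb_closure_min (mlb_closure_closed _ _ A) (subxx _).
Qed.

Lemma max_lower_bounds_le (d : Order.disp_t) (P : finPOrderType d)
    (B : {set P}) (z b : P) : z \in max_lower_bounds B -> b \in B -> z <= b.
Proof. by rewrite !inE => /andP[/forall_inP zB _] /zB. Qed.

(** A set [B] inside the union either meets the ideal, and then all its lower
    bounds lie in the ideal, or is contained in [A], which is closed. *)
Lemma mlb_closed_setU_ideal (d : Order.disp_t) (P : finPOrderType d)
    (A : {set P}) (y : P) :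
  mlb_closed A -> mlb_closed (A :|: [set z | z <= y]).
Proof.
move=> /mlb_closedP Acl; apply/mlb_closedP => B sB; apply/subsetP => z zB.
rewrite !inE; have [sBA | /subsetPn[b bB bA]] := boolP (B \subset A).
  by rewrite (subsetP (Acl B sBA)).
have := subsetP sB b bB; rewrite !inE (negPf bA) /= => le_by.
by rewrite (le_trans (max_lower_bounds_le _ _ _ _ _ zB bB) le_by) orbT.
Qed.

Lemma mlb_closure_setU1_le (d : Order.disp_t) (P : finPOrderType d)
    (A : {set P}) (x y : P) :
  mlb_closed A -> x \notin A -> x \in mlb_closure (y |: A) -> x <= y.
Proof.
move=> Acl xA xyA.
have sU : y |: A \subset A :|: [set z | z <= y].
  by rewrite setUC setUS // sub1set inE.
have := subsetP (mlb_closure_min _ _ _ _ (mlb_closed_setU_ideal _ _ _ y Acl) sU) x xyA.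
by rewrite !inE (negPf xA).
Qed.

Theorem proposition5 (d : Order.disp_t) (P : finPOrderType d) :
  is_convex_closure (@mlb_closure d P).
Proof.
split; first exact: mlb_closure_is_closure.
move=> x y A neq_xy clA xA yA x_in; apply/negP => y_in; apply: neq_xy.
have Acl : mlb_closed A by rewrite -clA mlb_closure_closed.
apply: le_anti.
by rewrite (mlb_closure_setU1_le _ _ A) // (mlb_closure_setU1_le _ _ A).
Qed.
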